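(* Let $N\ge2$, let $U_1,\dots,U_N\in\mathcal{U}^{\mathrm{ALKY}}_N$, and let $\alpha=(\alpha_{i,j})_{1\le i<j\le N}$ be a weight list such that $\alpha_{i,j}\in[0,1)$ for all $i<j$ and such that there is no $i\in\{1,\dots,N\}$ with $\alpha_{i,j}=0$ for all $j\neq i$. Then: 1. There exists a unique compatibility list $\bar C=(\bar c_{i,j})_{1\le i<j\le N}\in(\mathbb{R}_{>0})^{\binom N2}$ such that $\alpha$ is the unique unconstrained solution of the Social Optimization Problem associated with $U_1,\dots,U_N$ and $\bar C$. 2. For every compatibility list $C$ in the set $$\underline{C}=\left\{C\in(\mathbb{R}_{>0})^{\binom N2}\ :\ c_{i,j}=\bar c_{i,j}\text{ if }\alpha_{i,j}>0,\quad c_{i,j}\in(0,\bar c_{i,j}]\text{ if }\alpha_{i,j}=0\right\},$$ $\alpha$ is the unique solution of the Social Optimization Problem associated with $U_1,\dots,U_N$ and $C$.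
   Context: Weight lists and compatibility lists are vectors indexed by unordered pairs of distinct individuals in $\{1,\dots,N\}$; one writes $\alpha_{i,j}=\alpha_{\min(i,j),\max(i,j)}$ and $c_{i,j}=c_{\min(i,j),\max(i,j)}$. For an individual $i$, $\alpha^i=(\alpha_{i,j})_{j\ne i}$ and $C^i=(c_{i,j})_{j\neq i}$ (both listed in the same order). $\mathcal{U}^{\mathrm{ALKY}}_N$ is the set of functions $U:[0,1)^{N-1}\times(\mathbb{R}_{>0})^{N-1}\to\mathbb{R}$ of the form $$U(a,c)=\sum_{j=1}^{N-1}\left[\kappa a_jc_j-\frac{a_j^{\gamma}}{1-a_j^{\gamma}}\right]-\left(\sum_{j=1}^{N-1}a_j\right)^{\delta}$$ for some real parameters $\kappa>1,\gamma>1,\delta>1$. The parameters may differ between individuals. The Social Optimization Problem associated with $U_1,\dots,U_N$ and a compatibility list $C$ is to maximize over $\beta$ the objective $\mathcal{O}(\beta,C)=\sum_{i=1}^N U_i(\beta^i,C^i)$ subject to $\beta\in[0,1)^{\binom N2}$ and to there being no $i$ with $\beta_{i,j}=0$ for all $j\ne i$. A solution is called unconstrained if it is a critical point of the objective, i.e. all partial derivatives $\partial\mathcal{O}/\partial\beta_{i,j}$ vanish at it (one-sided derivatives being used at coordinates equal to $0$). *)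

(* Defs.v *)
(* The real numbers are an arbitrary [R : realType]. *)
From HB Require Import structures.
From mathcomp Require Import all_boot all_order all_algebra.
From mathcomp Require Import all_classical all_reals all_analysis.

Set Implicit Arguments.
Unset Strict Implicit.
Unset Printing Implicit Defensive.

Import Order.TTheory GRing.Theory Num.Theory.
Import numFieldNormedType.Exports.

Local Open Scope classical_set_scope.
Local Open Scope ring_scope.

(* An unordered pair of distinct individuals is listed increasingly. *)
Notation upair N := {p : 'I_N * 'I_N | (p.1 < p.2)%N}.

Notation pair_list R N := {ffun upair N -> R}.

(* [entry w i j] is w_{min(i,j),max(i,j)}; the default value 0 is reached only
   when i = j, and is not used below. *)
Definition entry (R : realType) (N : nat) (w : pair_list R N) (i j : 'I_N) : R :=
  if insub (Order.min i j, Order.max i j) is Some e then w e else 0.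

(* [lift i] enumerates the individuals other than i in increasing order. *)
Definition indiv (R : realType) (N : nat) (w : pair_list R N) (i : 'I_N) :
  'rV[R]_N.-1 := \row_k entry w i (lift i k).

(* Only the values on [0,1)^(N-1) x (R_{>0})^(N-1) are constrained. On a >= 0,
   [powR] is the usual power; in particular 0 `^ gamma = 0 for gamma > 1. *)
Definition U_ALKY (R : realType) (N : nat) :
    set ('rV[R]_N.-1 -> 'rV[R]_N.-1 -> R) :=
  [set U | exists kappa gamma delta : R,
    [/\ 1 < kappa, 1 < gamma, 1 < delta &
      forall a c : 'rV[R]_N.-1,
        (forall j, 0 <= a 0 j < 1) -> (forall j, 0 < c 0 j) ->
        U a c =
          \sum_(j < N.-1) (kappa * a 0 j * c 0 j
                           - (a 0 j) `^ gamma / (1 - (a 0 j) `^ gamma))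
          - (\sum_(j < N.-1) a 0 j) `^ delta]].

Definition objective (R : realType) (N : nat)
    (U : 'I_N -> 'rV[R]_N.-1 -> 'rV[R]_N.-1 -> R) (beta C : pair_list R N) : R :=
  \sum_(i < N) U i (indiv beta i) (indiv C i).

Definition pos_list (R : realType) (N : nat) : set (pair_list R N) :=
  [set C : pair_list R N | forall e, 0 < C e].

Definition feasible (R : realType) (N : nat) : set (pair_list R N) :=
  [set beta : pair_list R N | (forall e, 0 <= beta e < 1) /\
    ~ (exists i : 'I_N, forall j : 'I_N, j != i -> entry beta i j = 0)].

Definition solution (R : realType) (N : nat)
    (U : 'I_N -> 'rV[R]_N.-1 -> 'rV[R]_N.-1 -> R) (C : pair_list R N) :
    set (pair_list R N) :=
  [set beta : pair_list R N | feasible beta /\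
    forall beta', feasible beta' -> objective U beta' C <= objective U beta C].

Definition set_coord (R : realType) (N : nat) (beta : pair_list R N)
    (e : upair N) (t : R) : pair_list R N :=
  [ffun e' => if e' == e then t else beta e'].

Definition partial_vanishes (R : realType) (N : nat) (F : pair_list R N -> R)
    (beta : pair_list R N) (e : upair N) : Prop :=
  if beta e == 0 then
    (h^-1 * (F (set_coord beta e h) - F beta)) @[h --> 0^'+] --> (0 : R)
  else is_derive (beta e) (1 : R) (fun t : R => F (set_coord beta e t)) (0 : R).

Definition unconstrained_solution (R : realType) (N : nat)
    (U : 'I_N -> 'rV[R]_N.-1 -> 'rV[R]_N.-1 -> R) (C : pair_list R N) :
    set (pair_list R N) :=
  [set beta : pair_list R N | solution U C beta /\
    forall e, partial_vanishes (fun b => objective U b C) beta e].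

Definition C_under (R : realType) (N : nat) (alpha Cbar : pair_list R N) :
    set (pair_list R N) :=
  [set C : pair_list R N | pos_list C /\
    forall e, (0 < alpha e -> C e = Cbar e) /\
              (alpha e = 0 -> 0 < C e <= Cbar e)].

(* Main.v *)
(* On the box [0,1)^pairs the objective is a strictly concave function of the
   weights, so it lies below its tangent hyperplane at [alpha], strictly except
   at [alpha].  Its partial derivatives at [alpha] are affine and increasing in
   the compatibilities, which determines [Cbar] as their zero; positivity comes
   from every individual having positive total weight.  Lowering [C e] where
   [alpha e = 0] makes the partial derivative nonpositive, and the tangent
   inequality over [b e >= 0] still gives that [alpha] is the unique maximiser. *)
Require Import Defs.
From mathcomp Require Import all_boot all_order all_algebra.
From mathcomp Require Import all_classical all_reals all_analysis.
From mathcomp Require Import ring lra.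
Import Order.TTheory GRing.Theory Num.Theory.
Import numFieldNormedType.Exports.
Local Open Scope classical_set_scope.
Local Open Scope ring_scope.

Set Implicit Arguments.
Unset Strict Implicit.
Unset Printing Implicit Defensive.

(** * Real powers: tangent inequality and continuity up to 0 *)

(** Young's inequality for [y] and [x ^ (p - 1)] with conjugate exponents [p] and [p / (p - 1)],
    multiplied by [p]. No derivative is taken, so [x = 0] is covered. *)
Lemma powR_tangent (R : realType) (p x y : R) : 1 < p -> 0 <= x -> 0 <= y ->
  x `^ p + p * x `^ (p - 1) * (y - x) <= y `^ p.
Proof.
move=> p1 x0 y0; have p0 : 0 < p by lra.
have p10 : 0 < p - 1 by lra.
have := @conjugate_powR R y (x `^ (p - 1)) p (p / (p - 1)) y0 (powR_ge0 _ _) p0.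
rewrite -powRrM (_ : (p - 1) * (p / (p - 1)) = p); last by field; lra.
rewrite divr_gt0// => /(_ isT).
rewrite (_ : p^-1 + _ = 1); last by field; lra.
move=> /(_ erefl) /(ler_wpM2l (ltW p0)).
rewrite mulrDr (_ : p * (x `^ p / _) = (p - 1) * x `^ p); last by field; lra.
rewrite (_ : p * (y `^ p / p) = y `^ p); last by field; lra.
by rewrite mulrBr -[_ * x]mulrA [_ * x]mulrC mulr_powRB1//; lra.
Qed.

Lemma cvg_powR (R : realType) (T : Type) (F : set_system T) (FF : Filter F)
    (f : T -> R) (x p : R) : 0 < p -> 0 <= x ->
  (\forall t \near F, 0 <= f t) -> f @ F --> x ->
  f t `^ p @[t --> F] --> x `^ p.
Proof.
move=> p0 x0 f0 fx; have [x_eq0|x_neq0] := eqVneq x 0; last first.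
  have xgt0 : 0 < x by rewrite lt_neqAle eq_sym x_neq0.
  have : {for x, continuous (@powR R ^~ p)}; last first.
    by move=> cp; exact: (continuous_cvg FF cp fx).
  apply/differentiable_continuous/derivable1_diffP.
  apply: (@derivable_powR R 1 p x).
  by rewrite in_itv/= andbT.
(* At 0 the differentiability argument fails; [f t < e ^ (1 / p)] gives [f t ^ p < e] directly. *)
rewrite x_eq0 powR0 ?gt_eqF//; rewrite x_eq0 in fx; apply/cvgr0Pnorm_lt => e e0.
have : 0 < e `^ p^-1 by exact: powR_gt0.
move/cvgr0Pnorm_lt : fx => /[apply] fx; near=> t.
have ft0 : 0 <= f t by near: t.
have ft : `|f t| < e `^ p^-1 by near: t.
rewrite ger0_norm ?powR_ge0//; rewrite ger0_norm// in ft.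
rewrite -[ltRHS](powRr1 (ltW e0)) -(mulVf (lt0r_neq0 p0)) powRrM.
by apply: gt0_ltr_powR => //; rewrite nnegrE// powR_ge0.
Unshelve. all: by end_near. Qed.

Lemma powR_lt1 (R : realType) (p x : R) : 0 < p -> 0 <= x < 1 -> x `^ p < 1.
Proof.
move=> p0 /andP[x0 x1]; rewrite -[ltRHS](congr1 (@^~ p) (@powR1 R)).
by apply: gt0_ltr_powR => //; rewrite nnegrE.
Qed.

(** * The one-variable cost term and its convexity *)

Definition cost (R : realType) (gamma x : R) : R := x `^ gamma / (1 - x `^ gamma).

(** The derivative of [cost gamma]; for [gamma > 1] its value at 0 is 0. *)
Definition cost_slope (R : realType) (gamma x : R) : R :=
  gamma * x `^ (gamma - 1) / (1 - x `^ gamma) ^+ 2.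

Lemma cost_slope_ge0 (R : realType) (gamma x : R) : 1 < gamma ->
  0 <= cost_slope gamma x.
Proof.
move=> g1; rewrite /cost_slope divr_ge0 ?sqr_ge0// mulr_ge0 ?powR_ge0//; lra.
Qed.

(* With [u = x `^ gamma] and [v = y `^ gamma], the function [u / (1 - u)] lies
   above its tangent by exactly [(v - u)^2 / ((1 - u)^2 (1 - v))]. *)
Lemma cost_tangent (R : realType) (gamma x y : R) : 1 < gamma ->
  0 <= x < 1 -> 0 <= y < 1 ->
  cost gamma x + cost_slope gamma x * (y - x) <= cost gamma y ?= iff (x == y).
Proof.
move=> g1 x01 y01; have g0 : 0 < gamma by lra.
have [x0 y0] : 0 <= x /\ 0 <= y by case/andP: x01; case/andP: y01.
have u1 := powR_lt1 g0 x01; have v1 := powR_lt1 g0 y01.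
have [<-|xy] := eqVneq x y; first by apply/leifP; rewrite subrr mulr0 addr0.
apply/leifP; have uv : x `^ gamma != y `^ gamma.
  by apply: contra xy => /eqP/powR_injective -> //; rewrite nnegrE.
have := powR_tangent g1 x0 y0; rewrite /cost /cost_slope.
set s := gamma * _; set u := x `^ _ in u1 uv *; set v := y `^ _ in v1 uv *.
move=> tg; have u2 : 0 < (1 - u) ^+ 2 by rewrite exprn_gt0//; lra.
(* The tangent inequality for the power, [s * (y - x) <= v - u], reduces the claim to the variables
   [u] and [v]. *)
have le : s / (1 - u) ^+ 2 * (y - x) <= (v - u) / (1 - u) ^+ 2.
  by rewrite mulrAC ler_pM2r ?invr_gt0//; lra.
apply: (le_lt_trans (lerD (lexx _) le)); rewrite -subr_gt0.
rewrite (_ : _ - _ = (v - u) ^+ 2 / ((1 - u) ^+ 2 * (1 - v))); last first.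
  by field; apply/andP; split; lra.
apply: divr_gt0; last by apply: mulr_gt0 => //; lra.
by rewrite exprn_even_gt0//= subr_eq0 eq_sym.
Qed.

Lemma cvg_cost_slope (R : realType) (T : Type) (F : set_system T)
    (FF : Filter F) (f : T -> R) (x gamma : R) : 1 < gamma -> 0 <= x < 1 ->
  (\forall t \near F, 0 <= f t) -> f @ F --> x ->
  cost_slope gamma (f t) @[t --> F] --> cost_slope gamma x.
Proof.
move=> g1 x01 f0 fx; have g0 : 0 < gamma by lra.
have x0 : 0 <= x by case/andP: x01.
apply: cvgM; first by apply: cvgMr; apply: cvg_powR => //; lra.
apply: cvgV; first by rewrite expf_neq0// lt0r_neq0// subr_gt0 powR_lt1.
rewrite expr2; under eq_fun do rewrite expr2.
by apply: cvgM; apply: cvgB; [exact: cvg_cst|exact: cvg_powR|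
  exact: cvg_cst|exact: cvg_powR].
Qed.

(** * Strict concavity of a single utility *)

Definition alky (R : realType) (n : nat) (kappa gamma delta : R)
    (a c : 'rV[R]_n) : R :=
  \sum_j (kappa * a 0 j * c 0 j - cost gamma (a 0 j))
  - (\sum_j a 0 j) `^ delta.

Definition alky_slope (R : realType) (n : nat) (kappa gamma delta : R)
    (a c : 'rV[R]_n) (j : 'I_n) : R :=
  kappa * c 0 j - cost_slope gamma (a 0 j)
  - delta * (\sum_k a 0 k) `^ (delta - 1).

(** The compatibility terms are linear and the power of the total weight gives a weak inequality.
    Strictness comes from the costs, at a coordinate where [a] and [b] differ. *)
Lemma alky_tangent (R : realType) (n : nat) (kappa gamma delta : R)
    (a b c : 'rV[R]_n) : 1 < gamma -> 1 < delta ->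
  (forall j, 0 <= a 0 j < 1) -> (forall j, 0 <= b 0 j < 1) ->
  alky kappa gamma delta b c <= alky kappa gamma delta a c
    + \sum_j alky_slope kappa gamma delta a c j * (b 0 j - a 0 j) ?= iff (a == b).
Proof.
move=> g1 d1 a01 b01; have [<-|ab] := eqVneq a b.
  apply/leifP; rewrite big1 ?addr0// => j _; by rewrite subrr mulr0.
apply/leifP.
have sum_ge0 (v : 'rV[R]_n) : (forall j, 0 <= v 0 j < 1) -> 0 <= \sum_j v 0 j.
  by move=> v01; apply: sumr_ge0 => j _; case/andP: (v01 j).
have := powR_tangent d1 (sum_ge0 _ a01) (sum_ge0 _ b01).
have /lt_leif := leif_sum (fun j (_ : predT j) => cost_tangent g1 (a01 j) (b01 j)).
have -> : ~~ [forall (j | predT j), a 0 j == b 0 j].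
  apply: contra ab => /forallP ab; apply/eqP/rowP => j.
  exact/eqP/(implyP (ab j)).
rewrite /alky /alky_slope; set s := _ `^ (delta - 1).
have -> : \sum_j (kappa * c 0 j - cost_slope gamma (a 0 j) - delta * s)
      * (b 0 j - a 0 j)
    = \sum_j (kappa * b 0 j * c 0 j) - \sum_j (kappa * a 0 j * c 0 j)
      - \sum_j (cost gamma (a 0 j)
                + cost_slope gamma (a 0 j) * (b 0 j - a 0 j))
      + \sum_j cost gamma (a 0 j)
      - delta * s * (\sum_j b 0 j - \sum_j a 0 j).
  rewrite -!sumrB mulr_sumr -!sumrN -!big_split/=.
  by apply: eq_bigr => j _; ring.
by rewrite !sumrB; lra.
Qed.

(** * Passage between individuals and unordered pairs *)

Lemma sum_upair (R : nmodType) (N : nat) (f : 'I_N -> 'I_N -> R) :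
  \sum_i \sum_(k < N.-1) f i (lift i k)
  = \sum_(e : upair N)
      (f (val e).1 (val e).2 + f (val e).2 (val e).1).
Proof.
(* Padding with 0 on the diagonal makes the inner sum run over all of ['I_N], ready to be split into
   [j > i] and [j < i]. *)
have sum_lift i :
    \sum_(k < N.-1) f i (lift i k) = \sum_(j < N) (if i == j then 0 else f i j).
  rewrite (bigD1_ord i)//= eqxx add0r; apply: eq_bigr => k _.
  by rewrite (negbTE (neq_lift i k)).
rewrite (eq_bigr _ (fun i _ => sum_lift i)).
have split_lt i : \sum_(j < N) (if i == j then 0 else f i j)
    = \sum_(j < N | (i < j)%N) f i j + \sum_(j < N | (j < i)%N) f i j.
  rewrite [in RHS]big_mkcond [X in _ + X]big_mkcond -big_split/=.
  apply: eq_bigr => j _; rewrite -val_eqE.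
  by case: ltngtP; rewrite ?addr0 ?add0r.
rewrite (eq_bigr _ (fun i _ => split_lt i)) big_split/=.
rewrite [X in _ + X](exchange_big_dep xpredT)//= -big_split/=.
under eq_bigr do rewrite -big_split/=.
rewrite pair_big_dep/= (reindex_omap (val : upair N -> _) insub) => [|p ltp].
  by apply: eq_bigl => e; rewrite valK (valP e) eqxx.
by rewrite /= insubT.
Qed.

Lemma entry_upair (R : realType) (N : nat) (w : pair_list R N) (e : upair N) :
  entry w (val e).1 (val e).2 = w e /\ entry w (val e).2 (val e).1 = w e.
Proof.
have lt_e : ((val e).1 < (val e).2)%O by rewrite ltEord (valP e).
rewrite /entry [Order.min (val e).2 _]minC [Order.max (val e).2 _]maxC.
by rewrite (min_l (ltW lt_e)) (max_r (ltW lt_e)) -surjective_pairing valK.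
Qed.

(** The pair [e] is chosen before [w], so that one coordinate serves several lists at once,
    including a list that varies along a filter. *)
Lemma entry_of_neq (N : nat) (i j : 'I_N) : i != j ->
  exists e : upair N, forall (R : realType) (w : pair_list R N),
    entry w i j = w e.
Proof.
move=> ij; have [lt_ij|] := ltnP i j.
  exists (exist _ (i, j) lt_ij) => R w.
  by case: (entry_upair w (exist _ (i, j) lt_ij)).
rewrite leq_eqVlt => /orP[/eqP/val_inj ji|lt_ji]; first by rewrite ji eqxx in ij.
exists (exist _ (j, i) lt_ji) => R w.
by case: (entry_upair w (exist _ (j, i) lt_ji)).
Qed.

Lemma indiv_entry (N : nat) (i : 'I_N) (k : 'I_N.-1) :
  exists e : upair N, forall (R : realType) (w : pair_list R N),
    indiv w i 0 k = w e.
Proof.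
have [e we] := entry_of_neq (neq_lift i k).
by exists e => R w; rewrite mxE we.
Qed.

(** Turns equality in every individual tangent inequality into equality of the weight lists. *)
Lemma indiv_inj (R : realType) (N : nat) (a b : pair_list R N) :
  (forall i, indiv a i = indiv b i) -> a = b.
Proof.
move=> ab; apply/ffunP => e; rewrite -(entry_upair a e).1 -(entry_upair b e).1.
have /unlift_some[k -> _] : (val e).1 != (val e).2.
  by rewrite -val_eqE/= neq_ltn (valP e).
by have /rowP/(_ k) := ab (val e).1; rewrite !mxE.
Qed.

(** * The gradient of the objective and its tangent inequality *)

Definition strength (R : realType) (N : nat) (a : pair_list R N) (i : 'I_N) : R :=
  \sum_k indiv a i 0 k.

(** The marginal loss of [i] when the weight of [e] grows; meaningful when [i] is a member of
    [e]. *)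
Definition burden (R : realType) (N : nat) (gamma delta : 'I_N -> R)
    (a : pair_list R N) (e : upair N) (i : 'I_N) : R :=
  cost_slope (gamma i) (a e) + delta i * strength a i `^ (delta i - 1).

(** The explicit partial derivative along [e]: a pair weight enters exactly the utilities of its two
    members. *)
Definition gradient (R : realType) (N : nat) (kappa gamma delta : 'I_N -> R)
    (C a : pair_list R N) (e : upair N) : R :=
  (kappa (val e).1 + kappa (val e).2) * C e
  - (burden gamma delta a e (val e).1 + burden gamma delta a e (val e).2).

Definition alky_family (R : realType) (N : nat) (kappa gamma delta : 'I_N -> R)
    (U : 'I_N -> 'rV[R]_N.-1 -> 'rV[R]_N.-1 -> R) : Prop :=
  forall i, [/\ 1 < kappa i, 1 < gamma i, 1 < delta i &
    forall a c : 'rV[R]_N.-1,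
      (forall j, 0 <= a 0 j < 1) -> (forall j, 0 < c 0 j) ->
      U i a c = alky (kappa i) (gamma i) (delta i) a c].

Lemma objective_tangent (R : realType) (N : nat) (kappa gamma delta : 'I_N -> R)
    (U : 'I_N -> 'rV[R]_N.-1 -> 'rV[R]_N.-1 -> R) (C a b : pair_list R N) :
  alky_family kappa gamma delta U -> pos_list C ->
  (forall e, 0 <= a e < 1) -> (forall e, 0 <= b e < 1) ->
  objective U b C <= objective U a C
    + \sum_e gradient kappa gamma delta C a e * (b e - a e) ?= iff (a == b).
Proof.
move=> HU C0 a01 b01.
have box (w : pair_list R N) : (forall e, 0 <= w e < 1) ->
    forall i j, 0 <= indiv w i 0 j < 1.
  by move=> w01 i j; have [e ->] := indiv_entry i j.
have cpos i j : 0 < indiv C i 0 j.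
  by have [e ->] := indiv_entry i j; exact: C0.
have -> : (a == b) = [forall i in 'I_N, indiv a i == indiv b i].
  apply/eqP/forallP => [-> i|ab]; first by rewrite eqxx implybT.
  by apply: indiv_inj => i; apply/eqP/(implyP (ab i)).
have -> : objective U a C + \sum_e gradient kappa gamma delta C a e * (b e - a e)
    = \sum_i (U i (indiv a i) (indiv C i) + \sum_j
        alky_slope (kappa i) (gamma i) (delta i) (indiv a i) (indiv C i) j
        * (indiv b i 0 j - indiv a i 0 j)).
  rewrite big_split/=; congr (_ + _).
  (* The contribution of the ordered pair [(i, j)]; [sum_upair] then merges the two orders of each
     pair. *)
  pose f i j := (kappa i * entry C i j - cost_slope (gamma i) (entry a i j)
    - delta i * strength a i `^ (delta i - 1)) * (entry b i j - entry a i j).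
  transitivity (\sum_i \sum_(k < N.-1) f i (lift i k)); last first.
    by apply: eq_bigr => i _; apply: eq_bigr => k _; rewrite /f /alky_slope !mxE.
  rewrite sum_upair; apply: eq_bigr => e _; rewrite /f.
  rewrite !(entry_upair _ e).1 !(entry_upair _ e).2 /gradient /burden; ring.
apply: leif_sum => i _; have [_ g1 d1 HUi] := HU i.
by rewrite !HUi; [apply: alky_tangent| | | |]; auto.
Qed.

(** * Continuity of the gradient and partial derivatives *)

Lemma set_coord_id (R : realType) (N : nat) (a : pair_list R N) (e : upair N) :
  set_coord a e (a e) = a.
Proof. by apply/ffunP => e'; rewrite ffunE; case: eqP => [->|]. Qed.

(** The filter is arbitrary so as to cover both the right-hand limit at a zero coordinate and the
    two-sided limit elsewhere. *)
Lemma cvg_strength (R : realType) (N : nat) (F : set_system R)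
    (FF : Filter F) (a : pair_list R N) (e : upair N) (i : 'I_N) :
  h @[h --> F] --> (0 : R) ->
  strength (set_coord a e (a e + h)) i @[h --> F] --> strength a i.
Proof.
move=> F0; apply: cvg_big => [|k _]; first exact: add_continuous.
have [e' ek] := indiv_entry i k.
rewrite ek; under eq_fun do rewrite ek ffunE.
have [->|_] := eqVneq e' e; last exact: cvg_cst.
by rewrite -[in nbhs _](addr0 (a e)); apply: cvgD => //; exact: cvg_cst.
Qed.

Lemma cvg_gradient (R : realType) (N : nat) (kappa gamma delta : 'I_N -> R)
    (F : set_system R) (FF : Filter F) (C a : pair_list R N) (e : upair N) :
  (forall i, 1 < gamma i) -> (forall i, 1 < delta i) ->
  (forall e, 0 <= a e < 1) ->
  h @[h --> F] --> (0 : R) -> (\forall h \near F, 0 <= a e + h < 1) ->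
  gradient kappa gamma delta C (set_coord a e (a e + h)) e @[h --> F]
    --> gradient kappa gamma delta C a e.
Proof.
move=> g1 d1 a01 F0 Fbox.
have cvg_burden i : burden gamma delta (set_coord a e (a e + h)) e i @[h --> F]
    --> burden gamma delta a e i.
  apply: cvgD.
    apply: cvg_cost_slope => //.
      by near=> h; rewrite ffunE eqxx; have /andP[] : 0 <= a e + h < 1 by near: h.
    under eq_fun do rewrite ffunE eqxx.
    by rewrite -[in nbhs _](addr0 (a e)); apply: cvgD => //; exact: cvg_cst.
  apply: cvgMr; apply: cvg_powR; last exact: cvg_strength.
  - by rewrite subr_gt0.
  - by apply: sumr_ge0 => k _; have [e' ->] := indiv_entry i k; case/andP: (a01 e').
  - near=> h; apply: sumr_ge0 => k _; have [e' ->] := indiv_entry i k.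
    rewrite ffunE; case: eqP => _; last by case/andP: (a01 e').
    by have /andP[] : 0 <= a e + h < 1 by near: h.
by apply: cvgB; [exact: cvg_cst|apply: cvgD].
Unshelve. all: by end_near. Qed.

(* Concavity gives [gradient (a + h) * h <= O (a + h) - O a <= gradient a * h],
   for the objective [O], so continuity of the gradient yields the derivative,
   also one-sided. *)
Lemma cvg_difference_quotient (R : realType) (N : nat)
    (kappa gamma delta : 'I_N -> R)
    (U : 'I_N -> 'rV[R]_N.-1 -> 'rV[R]_N.-1 -> R)
    (F : set_system R) (FF : Filter F) (C a : pair_list R N) (e : upair N) :
  alky_family kappa gamma delta U -> pos_list C ->
  (forall e, 0 <= a e < 1) ->
  h @[h --> F] --> (0 : R) ->
  (\forall h \near F, h != 0 /\ 0 <= a e + h < 1) ->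
  h^-1 * (objective U (set_coord a e (a e + h)) C - objective U a C) @[h --> F]
    --> gradient kappa gamma delta C a e.
Proof.
move=> HU C0 a01 F0 Fbox.
set g := gradient kappa gamma delta C a e.
pose g' h := gradient kappa gamma delta C (set_coord a e (a e + h)) e.
have g'g : g' h @[h --> F] --> g.
  apply: cvg_gradient => // [i|i|]; [by case: (HU i)|by case: (HU i)|].
  by near=> h; have [] : h != 0 /\ 0 <= a e + h < 1 by near: h.
have dist0 : `|g' h - g| @[h --> F] --> (0 : R).
  by have := cvg_norm (cvgB g'g (cvg_cst g)); rewrite subrr normr0; apply.
(* The sign of [h] decides which of [g] and [g' h] is the upper bound; the symmetric bounds
   [g - |g' h - g|] and [g + |g' h - g|] serve both signs. *)
apply: (@squeeze_cvgr _ _ _ _ (fun h => g - `|g' h - g|)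
  (fun h => g + `|g' h - g|)).
- near=> h; have [h0 h01] : h != 0 /\ 0 <= a e + h < 1 by near: h.
  pose b := set_coord a e (a e + h).
  have b01 e' : 0 <= b e' < 1 by rewrite ffunE; case: eqP.
  (* Only the coordinate [e] moves, so the linear form has one term; [c] is 1 from [a] to [b] and -1
     back. *)
  have sum_e (f : upair N -> R) (c : R) :
      \sum_e' f e' * (c * (b e' - a e')) = f e * (c * h).
    rewrite (bigD1 e)//= big1 => [|e' /negbTE ne]; last first.
      by rewrite ffunE ne subrr !mulr0.
    by rewrite ffunE eqxx addr0 addrAC subrr add0r.
  have [upper _] := objective_tangent HU C0 a01 b01.
  have [lower _] := objective_tangent HU C0 b01 a01.
  have := sum_e (gradient kappa gamma delta C a) 1.
  have := sum_e (gradient kappa gamma delta C b) (-1).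
  under eq_bigr do rewrite mulN1r opprB.
  under [in X in _ -> X -> _]eq_bigr do rewrite mul1r.
  rewrite mulN1r mul1r => eqb eqa; rewrite {}eqa in upper; rewrite {}eqb in lower.
  rewrite -/b -/(g' h) -/g in upper lower *.
  have {}lower : g' h * h <= objective U b C - objective U a C.
    by move: lower; rewrite -/(g' h); lra.
  have {}upper : objective U b C - objective U a C <= g * h by lra.
  have /andP[dl du] : - `|g' h - g| <= g' h - g <= `|g' h - g|.
    by rewrite -ler_norml.
  have [hpos|hneg] := ltP 0 h.
    rewrite mulrC ler_pdivlMr// ler_pdivrMr//.
    by nra.
  have {}hneg : h < 0 by rewrite lt_neqAle h0.
  rewrite mulrC ler_ndivlMr// ler_ndivrMr//.
  by nra.
- by have := cvgB (cvg_cst g) dist0; rewrite subr0; apply.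
- by have := cvgD (cvg_cst g) dist0; rewrite addr0; apply.
Unshelve. all: by end_near. Qed.

(** Either branch of [partial_vanishes] concerns the limit of a difference quotient, which is the
    gradient; uniqueness of limits concludes. *)
Lemma partial_vanishes_gradient (R : realType) (N : nat)
    (kappa gamma delta : 'I_N -> R)
    (U : 'I_N -> 'rV[R]_N.-1 -> 'rV[R]_N.-1 -> R)
    (C a : pair_list R N) (e : upair N) :
  alky_family kappa gamma delta U -> pos_list C ->
  (forall e, 0 <= a e < 1) ->
  partial_vanishes (fun b => objective U b C) a e
    <-> gradient kappa gamma delta C a e = 0.
Proof.
move=> HU C0 a01; rewrite /partial_vanishes; case/andP: (a01 e) => a0 a1.
have [ae0|ae_neq0] := eqVneq (a e) 0.
  have : h^-1 * (objective U (set_coord a e h) C - objective U a C) @[h --> 0^'+]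
      --> gradient kappa gamma delta C a e.
    under eq_fun => h do rewrite -[in set_coord _ _ h](add0r h)
      -[0 + h](congr1 (+%R^~ h) ae0).
    apply: cvg_difference_quotient => //; first exact: cvg_at_right_filter cvg_id.
    near=> h; rewrite ae0 add0r; split; first by rewrite gt_eqF.
    by apply/andP; split; [exact: ltW|near: h; exact: nbhs_right_lt].
  move=> lim; split => [lim0|g0]; last by rewrite g0 in lim.
  exact: (cvg_unique _ lim lim0).
have lim : h^-1 *: (((fun t => objective U (set_coord a e t) C) \o shift (a e))
        (h *: (1 : R)) - objective U (set_coord a e (a e)) C) @[h --> 0^']
    --> gradient kappa gamma delta C a e.
  rewrite set_coord_id.
  rewrite [X in X @ _](_ : _ = fun h => h^-1
      * (objective U (set_coord a e (a e + h)) C - objective U a C)); last first.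
    by apply/funext => h /=; rewrite /GRing.scale/= mulr1 [h + _]addrC.
  apply: cvg_difference_quotient => //.
    exact: nbhs_dnbhs.
  (* This radius keeps [a e + h] inside the box for [h] of either sign. *)
  have m0 : 0 < Num.min (a e) (1 - a e).
    by rewrite lt_min subr_gt0 a1 lt_neqAle eq_sym ae_neq0 a0.
  near=> h; split; first by near: h; exact: nbhs_dnbhs_neq.
  have : `|h| < Num.min (a e) (1 - a e) by near: h; exact: dnbhs0_lt.
  by rewrite lt_min !ltr_norml => /andP[/andP[? _] /andP[_ ?]]; lra.
split=> [[_ <-]|g0].
  exact/esym/cvg_lim.
by split; [apply/cvg_ex; eexists; exact: lim|rewrite -g0; exact/cvg_lim].
Unshelve. all: by end_near. Qed.

(** * Construction of [Cbar], optimality and uniqueness *)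

Theorem theorem2 (R : realType) (N : nat) (hN : (2 <= N)%N)
  (U : 'I_N -> 'rV[R]_N.-1 -> 'rV[R]_N.-1 -> R)
  (hU : forall i : 'I_N, @U_ALKY R N (U i))
  (alpha : pair_list R N)
  (halpha : forall e : upair N, 0 <= alpha e < 1)
  (hiso : ~ (exists i : 'I_N, forall j : 'I_N, j != i -> entry alpha i j = 0)) :
  exists Cbar : pair_list R N,
    unique (fun C : pair_list R N =>
              pos_list C /\ unique (unconstrained_solution U C) alpha) Cbar /\
    (forall C : pair_list R N, C_under alpha Cbar C ->
       unique (solution U C) alpha).
Proof.
have [kappa [gamma [delta HU]]] : exists kappa gamma delta : 'I_N -> R,
    alky_family kappa gamma delta U.
  have [kappa /choice[gamma /choice[delta HU]]] := choice hU.
  by exists kappa, gamma, delta.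
have ksum_gt0 (e : upair N) : 0 < kappa (val e).1 + kappa (val e).2.
  by case: (HU (val e).1) (HU (val e).2) => ? _ _ _ [? _ _ _]; lra.
(* Here [hiso] enters: positive total weight keeps the burden positive even where the cost slope is
   0. *)
have strength_gt0 i : 0 < strength alpha i.
  have indiv_ge0 k : 0 <= indiv alpha i 0 k.
    by have [e ->] := indiv_entry i k; case/andP: (halpha e).
  rewrite lt_neqAle eq_sym sumr_ge0// andbT.
  apply/negP => /eqP/psumr_eq0P si0; apply: hiso; exists i => j.
  rewrite eq_sym => /unlift_some[k -> _].
  by have := si0 (fun k _ => indiv_ge0 k) k isT; rewrite mxE.
have burden_gt0 e i : 0 < burden gamma delta alpha e i.
  have [_ g1 d1 _] := HU i; apply: ltr_wpDl; first exact: cost_slope_ge0.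
  by apply: mulr_gt0; [lra|exact: powR_gt0].
(* The root of the gradient at [alpha], an affine equation in each [C e] separately. *)
pose Cbar : pair_list R N := [ffun e => (burden gamma delta alpha e (val e).1
  + burden gamma delta alpha e (val e).2) / (kappa (val e).1 + kappa (val e).2)].
have Cbar_gt0 : pos_list Cbar.
  by move=> e; rewrite ffunE divr_gt0// addr_gt0.
have gradE C e : gradient kappa gamma delta C alpha e
    = (kappa (val e).1 + kappa (val e).2) * (C e - Cbar e).
  by rewrite /gradient ffunE mulrBr [X in _ = _ - X]mulrC divfK// gt_eqF.
have sol C : C_under alpha Cbar C -> unique (solution U C) alpha.
  move=> [C0 Cle].
  (* Each term is nonpositive: if [alpha e > 0] the gradient is 0; if [alpha e = 0] it is at most 0
     and multiplies [b e >= 0]. *)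
  have lin_le0 b : (forall e, 0 <= b e < 1) ->
      \sum_e gradient kappa gamma delta C alpha e * (b e - alpha e) <= 0.
    move=> b01; apply: sumr_le0 => e _; rewrite gradE.
    have [Cpos Czero] := Cle e; have := halpha e.
    rewrite le_eqVlt => /andP[/predU1P[/esym ae0|ae_gt0] _]; last first.
      by rewrite Cpos// subrr mulr0 mul0r.
    have /andP[_ CCbar] := Czero ae0; case/andP: (b01 e) => b0 _.
    by rewrite ae0 subr0 mulr_le0_ge0// pmulr_rle0// subr_le0.
  split=> [|b [[b01 _] b_max]].
    split=> // b [b01 _]; have [le_b _] := objective_tangent HU C0 halpha b01.
    by have := lin_le0 _ b01; lra.
  (* A maximiser [b] attains equality in the tangent inequality, whose equality case is
     [alpha = b]. *)
  have [le_b eq_b] := objective_tangent HU C0 halpha b01.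
  have := b_max alpha (conj halpha hiso); have := lin_le0 _ b01 => lin0 max_b.
  by apply/eqP; rewrite -eq_b eq_le le_b/=; lra.
exists Cbar; split=> //; split.
  (* [Cbar] lies in its own [C_under], so the second claim supplies optimality in the first. *)
  have Cbar_under : C_under alpha Cbar Cbar.
    by split=> // e; split=> // _; rewrite lexx andbT; exact: Cbar_gt0.
  have [alpha_sol alpha_uniq] := sol _ Cbar_under.
  split=> //; split=> [|b [b_sol _]]; last exact: alpha_uniq.
  split=> // e; apply/(partial_vanishes_gradient e HU Cbar_gt0 halpha).
  by rewrite gradE subrr mulr0.
(* Criticality of [alpha] makes the gradient for [C] vanish, and its slope in [C e] is positive. *)
move=> C [C0 [[_ crit] _]]; apply/ffunP => e.
have /(partial_vanishes_gradient e HU C0 halpha)/eqP := crit e.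
by rewrite gradE mulf_eq0 (gt_eqF (ksum_gt0 e)) orFb subr_eq0 => /eqP ->.
Qed.
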